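(* Let $K$ be a field. Then every polycyclic-by-finite group (e.g., every free abelian group $\mathbb{Z}^d$, $d \geq 1$) is of $K$-linear Markov type.
   Context: A group $G$ is polycyclic if it admits a finite sequence of subgroups $G = G_0 \supset G_1 \supset \cdots \supset G_n = \{1_G\}$ such that $G_{i+1}$ is normal in $G_i$ and $G_i/G_{i+1}$ is a (possibly infinite) cyclic group for all $0 \le i \le n-1$; it is polycyclic-by-finite if it admits a polycyclic subgroup of finite index. For a finite-dimensional $K$-vector space $A$, $A^G$ is the $K$-vector space of all maps $x \colon G \to A$, equipped with the prodiscrete topology (product topology with each factor $A$ discrete) and with the shift action of $G$ given by $(gx)(h) = x(g^{-1}h)$. A linear subshift of $A^G$ is a closed $G$-invariant vector subspace of $A^G$. A subset $\Sigma \subset A^G$ is a subshift of finite type (SFT) if there exist a finite subset $D \subset G$ and a subset $P \subset A^D$ such that $\Sigma = \{x \in A^G : (g^{-1}x)|_D \in P \text{ for all } g \in G\}$. The group $G$ is of $K$-linear Markov type if, for every finite-dimensional vector space $A$ over $K$, every linear subshift $\Sigma \subset A^G$ is an SFT. *)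

(* Defs.v *)
(* Groups are arbitrary (possibly infinite) groupTypes; subgroups are classical
   sets. *)
From HB Require Import structures.
From mathcomp Require Import all_boot all_order all_algebra.
From mathcomp Require Import all_classical topology.

Set Implicit Arguments.
Unset Strict Implicit.
Unset Printing Implicit Defensive.

Local Open Scope classical_set_scope.

Section Polycyclic.
Variable G : groupType.
Implicit Types (H N : set G) (g x : G).

Definition expgz g (n : int) : G :=
  match n with Posz m => (g ^+ m)%g | Negz m => (g ^- m.+1)%g end.

Definition subgroup H : Prop := group_closed (mem H).

Definition left_coset g H : set G := [set (g * h)%g | h in H].

Definition normal_in N H : Prop :=
  N `<=` H /\ forall g n, H g -> N n -> N (n ^ g)%g.

(* For N normal in H, the n-th power of the class gN in H / N is the coset
   (g^n)N; the quotient is cyclic when these powers exhaust it. *)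
Definition cyclic_quotient H N : Prop :=
  exists2 g, H g &
    forall x, H x -> exists n : int, left_coset x N = left_coset (expgz g n) N.

Definition polycyclic H : Prop :=
  exists (n : nat) (S : nat -> set G),
    [/\ S 0%N = H, S n = [set 1%g],
        forall i, (i <= n)%N -> subgroup (S i) &
        forall i, (i < n)%N ->
          normal_in (S i.+1) (S i) /\ cyclic_quotient (S i) (S i.+1)].

Definition finite_index H : Prop :=
  finite_set [set left_coset g H | g in [set: G]].

Definition polycyclic_by_finite : Prop :=
  exists H, [/\ subgroup H, polycyclic H & finite_index H].

End Polycyclic.

Section Subshifts.
Variables (K : fieldType) (G : groupType).

(* A^G with the product of the discrete topologies; as a type it is G -> A. *)
Definition prodiscrete (A : choiceType) : topologicalType :=
  {ptws G -> discrete_topology A}.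

Definition shift (A : Type) (g : G) (x : G -> A) : G -> A :=
  fun h => x (g^-1 * h)%g.

Definition linear_subshift (A : vectType K) (Sigma : set (G -> A)) : Prop :=
  [/\ closed (Sigma : set (prodiscrete A)),
      forall g x, Sigma x -> Sigma (shift g x) &
      GRing.submod_closed (mem Sigma)].

Definition sft (A : Type) (Sigma : set (G -> A)) : Prop :=
  exists (D : set G) (P : set (D -> A)),
    finite_set D /\
    Sigma = [set x | forall g : G, P (sigL D (shift g^-1%g x))].

Definition linear_markov_type : Prop :=
  forall (A : vectType K) (Sigma : set (G -> A)),
    linear_subshift Sigma -> sft Sigma.

End Subshifts.

Arguments polycyclic_by_finite G : clear implicits.
Arguments linear_markov_type K G : clear implicits.

Definition free_abelian (d : nat) : groupType := Algebra.to_multiplicative 'rV[int]_d.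

(* Main.v *)
(* Let V be the space of K-valued functionals on A^G, on which G acts through
   the shift.  The evaluations x |-> x(g)_i span a copy of K[G]^(dim A), and
   a closed subspace Sigma of A^G is the common zero set of the finitely
   supported functionals that vanish on it: a point outside Sigma is already
   separated from Sigma by its restriction to a finite set, hence by a linear
   form in finitely many coordinates.  If these functionals are generated, as a
   module over a subgroup H, by finitely many of them, then Sigma is the SFT
   defined on the union of the supports of the generators.

   Finite generation is P. Hall's theorem.  If N is normal in H, H / N is
   generated by the class of g and W is a Noetherian N-module, then
   \sum_n g^n W is a Noetherian H-module by the argument of Hilbert's basis
   theorem.  The sum need not be direct, so finite and infinite cyclic quotients
   are treated alike.  Climbing a polycyclic series from the lines K v shows that
   every vector lies in a Noetherian H-module; a finite transversal of H then
   covers all evaluations. *)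
Require Import Defs.
From mathcomp Require Import all_boot all_order all_algebra.
From mathcomp Require Import all_classical topology.

Set Implicit Arguments.
Unset Strict Implicit.
Unset Printing Implicit Defensive.

Import GRing.Theory.
Local Open Scope classical_set_scope.
Local Open Scope ring_scope.

(** * Closure properties of subgroups given as sets *)

Section SubgroupTheory.
Variables (G : groupType) (H : set G).
Hypothesis sgH : subgroup H.

Lemma subgroup1 : H 1%g.
Proof. by case: sgH => /set_mem. Qed.

Lemma subgroupV g : H g -> H g^-1%g.
Proof. by move=> /mem_set Hg; apply: set_mem; exact: group_closedV sgH _ Hg. Qed.

Lemma subgroupM g h : H g -> H h -> H (g * h)%g.
Proof.
move=> /mem_set Hg /mem_set Hh; apply: set_mem.
exact: group_closedM sgH _ _ Hg Hh.
Qed.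

Lemma subgroupX g n : H g -> H (g ^+ n)%g.
Proof.
move=> Hg; elim: n => [|n IHn]; first by rewrite expg0; exact: subgroup1.
by rewrite expgS; exact: subgroupM.
Qed.

End SubgroupTheory.

(** * Noetherian modules over a group acting linearly *)

Section NoetherianModules.
Variables (K : fieldType) (G : groupType) (V : lmodType K).
Variable rho : G -> V -> V.
Hypothesis rho_linear : forall g, linear (rho g).
Hypothesis rho1 : forall v, rho 1%g v = v.
Hypothesis rhoM : forall g h v, rho (g * h)%g v = rho g (rho h v).
Implicit Types (H N : set G) (U W : set V) (g h : G) (u v w : V).

Let rhoP g a u v : rho g (a *: u + v) = a *: rho g u + rho g v.
Proof. exact: rho_linear. Qed.

Let rhoD g u v : rho g (u + v) = rho g u + rho g v.
Proof. by have := rhoP g 1 u v; rewrite !scale1r. Qed.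

Let rho0 g : rho g 0 = 0.
Proof. by apply: (@addrI _ (rho g 0)); rewrite -rhoD !addr0. Qed.

Let rhoK g v : rho g (rho g^-1 v)%g = v.
Proof. by rewrite -rhoM mulgV rho1. Qed.

Let rhoVK g v : rho g^-1%g (rho g v) = v.
Proof. by rewrite -rhoM mulVg rho1. Qed.

Definition submodule H U : Prop :=
  [/\ U 0, forall a u v, U u -> U v -> U (a *: u + v) &
      forall h u, H h -> U u -> U (rho h u)].

(** For a submodule [U], this makes [U] the least submodule containing [s]; the group ring K[H]
    never has to be formed. *)
Definition finitely_generated H U : Prop :=
  exists2 s : seq V, (forall v, v \in s -> U v) &
    forall U', submodule H U' -> (forall v, v \in s -> U' v) -> U `<=` U'.

Definition noetherian H W : Prop :=
  submodule H W /\
  forall U, submodule H U -> U `<=` W -> finitely_generated H U.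

Lemma submoduleD H U u v : submodule H U -> U u -> U v -> U (u + v).
Proof. by move=> [_ UP _] Uu Uv; rewrite -[u]scale1r; exact: UP. Qed.

Lemma submoduleZ H U a u : submodule H U -> U u -> U (a *: u).
Proof. by move=> [U0 UP _] Uu; rewrite -[_ *: _]addr0; exact: UP. Qed.

Lemma submoduleB H U u v : submodule H U -> U u -> U v -> U (u - v).
Proof. by move=> [_ UP _] Uu Uv; rewrite addrC -scaleN1r; exact: UP. Qed.

Lemma submoduleS H N U : N `<=` H -> submodule H U -> submodule N U.
Proof. by move=> NH [U0 UP UH]; split=> // h u /NH; exact: UH. Qed.

Lemma submoduleI H U W : submodule H U -> submodule H W -> submodule H (U `&` W).
Proof.
move=> [U0 UP UH] [W0 WP WH]; split=> //.
- by move=> a u v [? ?] [? ?]; split; [exact: UP|exact: WP].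
- by move=> h u Hh [? ?]; split; [exact: UH|exact: WH].
Qed.

Definition sum_set U W : set V := [set v | exists u w, [/\ U u, W w & v = u + w]].

Lemma submodule_sum H U W :
  submodule H U -> submodule H W -> submodule H (sum_set U W).
Proof.
move=> [U0 UP UH] [W0 WP WH]; split.
- by exists 0, 0; rewrite addr0.
- move=> a _ _ [u][w][Uu Ww ->] [u'][w'][Uu' Ww' ->].
  exists (a *: u + u'), (a *: w + w'); split; [exact: UP|exact: WP|].
  by rewrite scalerDr addrACA.
- move=> h _ Hh [u][w][Uu Ww ->]; exists (rho h u), (rho h w).
  by split; [exact: UH|exact: WH|exact: rhoD].
Qed.

Lemma submodule0 H : submodule H [set 0].
Proof.
split=> [//|a _ _ -> ->|h _ _ ->]; first by rewrite /= scaler0 addr0.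
by rewrite /= rho0.
Qed.

Lemma noetherian0 H : noetherian H [set 0].
Proof.
split; first exact: submodule0.
move=> U [U0 _ _] U1; exists [::] => // U' [U'0 _ _] _ u /U1 ->.
exact: U'0.
Qed.

(** A submodule containing a nonzero multiple of [v] is the whole line, and any other one is zero.
    The climb along a series starts here. *)
Lemma noetherian_line v :
  noetherian [set 1%g] [set a *: v | a in [set: K]].
Proof.
split.
  split; first by exists 0 => //; rewrite scale0r.
    move=> a _ _ [b _ <-] [c _ <-]; exists (a * b + c) => //.
    by rewrite scalerDl scalerA.
  by move=> h _ -> [b _ <-]; exists b => //; rewrite rho1.
move=> U sU UW; have [[a a0 Ua]|nU] := pselect (exists2 a, a != 0 & U (a *: v)).
  exists [:: v].
    move=> w; rewrite inE => /eqP ->.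
    by rewrite -[v]scale1r -(mulVf a0) -scalerA; exact: submoduleZ sU _.
  move=> U' sU' U'v u /UW[b _ <-]; apply: (submoduleZ _ sU').
  by apply: U'v; rewrite inE.
exists [::] => // U' [U'0 _ _] _ u Uu; have [b _ bu] := UW _ Uu.
have [b0|b0] := eqVneq b 0; first by rewrite -bu b0 scale0r.
by case: nU; exists b => //; rewrite bu.
Qed.

(** An extension argument without quotients: [U] is controlled by its components in [W1] and by its
    intersection with [W2]. *)
Lemma noetherian_sum H W1 W2 :
  noetherian H W1 -> noetherian H W2 -> noetherian H (sum_set W1 W2).
Proof.
move=> [sW1 nW1] [sW2 nW2]; split; first exact: submodule_sum.
move=> U sU UW.
(* The sum need not be direct, so all possible [W1]-components of elements of [U'] are collected. *)
pose pr U' := [set w1 | W1 w1 /\ exists2 w2, W2 w2 & U' (w1 + w2)].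
have pr_sub U' : submodule H U' -> submodule H (pr U').
  move: sW1 sW2 => [W10 W1P W1H] [W20 W2P W2H] [U'0 U'P U'H]; split.
  - by split=> //; exists 0; rewrite ?addr0.
  - move=> a u v [W1u [u' W2u' Uu]] [W1v [v' W2v' Uv]].
    split; first exact: W1P.
    exists (a *: u' + v'); first exact: W2P.
    by rewrite addrACA -scalerDr; exact: U'P.
  - move=> h u Hh [W1u [u' W2u' Uu]]; split; first exact: W1H.
    by exists (rho h u'); [exact: W2H|rewrite -rhoD; exact: U'H].
have [s1 s1P s1gen] := nW1 _ (pr_sub _ sU) (fun w => @proj1 _ _).
have [s2 s2P s2gen] := nW2 _ (submoduleI sU sW2) (fun w => @proj2 _ _).
have [f fP] : exists f : V -> V, forall w, w \in s1 -> W2 (f w) /\ U (w + f w).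
  have /choice[f fP] : forall w, exists w2, w \in s1 -> W2 w2 /\ U (w + w2).
    move=> w; have [/s1P[_ [w2 ? ?]]|] := boolP (w \in s1); first by exists w2.
    by exists 0.
  by exists f.
exists ([seq w + f w | w <- s1] ++ s2).
  move=> v; rewrite mem_cat => /orP[/mapP[w /fP[_ ?] ->] //|/s2P[] //].
move=> U' sU' U's u Uu.
have sUU' := submoduleI sU sU'.
have s1' w : w \in s1 -> pr (U `&` U') w.
  move=> ws; have [W1w _] := s1P _ ws; have [? ?] := fP _ ws.
  split=> //; exists (f w) => //; split=> //; apply: U's.
  by rewrite mem_cat (map_f (fun w => w + f w) ws).
have [u1 [u2 [W1u1 W2u2 uE]]] := UW _ Uu.
(* Generation is applied to the intersection of [U] and [U'], so that the new lift of [u1] lies in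
   both; its difference from [u] then falls into [W2]. *)
have /(s1gen _ (pr_sub _ sUU') s1')[_ [w2 W2w2 [Uw U'w]]] : pr U u1.
  by split=> //; exists u2 => //; rewrite -uE.
have -> : u = (u1 + w2) + (u - (u1 + w2)) by rewrite addrC subrK.
apply: (submoduleD sU') => //; apply: (s2gen _ sU').
  by move=> v vs; apply: U's; rewrite mem_cat vs orbT.
split; first exact: submoduleB sU _ _.
by rewrite uE opprD addrACA subrr add0r; exact: submoduleB sW2 _ _.
Qed.

(** * Translates by normalizing elements *)

(** Conjugation in one direction alone could map [N] onto a proper subset of itself. *)
Definition normalizes N g : Prop :=
  forall n, N n -> N (n ^ g)%g /\ N (n ^ g^-1)%g.

Let rho_conj n g v : rho n (rho g v) = rho g (rho (n ^ g)%g v).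
Proof. by rewrite -!rhoM conjgE !mulgA mulgV mul1g. Qed.

Lemma normalizesV N g : normalizes N g -> normalizes N g^-1%g.
Proof. by move=> Ng n /Ng[? ?]; rewrite invgK. Qed.

Lemma submodule_translate N g W :
  normalizes N g -> submodule N W -> submodule N (rho g @` W).
Proof.
move=> Ng [W0 WP WN]; split.
- by exists 0 => //; rewrite rho0.
- move=> a _ _ [u Wu <-] [v Wv <-]; exists (a *: u + v); first exact: WP.
  exact: rhoP.
- move=> n _ /Ng[Nn _] [u Wu <-]; exists (rho (n ^ g)%g u); first exact: WN.
  exact/esym/rho_conj.
Qed.

(** Submodules are pulled back by the inverse of [g] and their generators pushed forward by [g];
    conjugation by [g] only permutes [N]. *)
Lemma noetherian_translate N g W :
  normalizes N g -> noetherian N W -> noetherian N (rho g @` W).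
Proof.
move=> Ng [sW nW]; split; first exact: submodule_translate.
move=> U sU UW; have NgV := normalizesV Ng.
have [|s sP sgen] := nW _ (submodule_translate NgV sU).
  by move=> _ [u /UW[w Ww <-] <-]; rewrite rhoVK.
exists (map (rho g) s).
  by move=> _ /mapP[w /sP[u Uu <-] ->]; rewrite rhoK.
move=> U' sU' U's u Uu; have sgU' := submodule_translate NgV sU'.
have [||v U'v /(congr1 (rho g))] := sgen _ sgU' _ (rho g^-1%g u).
- move=> v vs; exists (rho g v); last exact: rhoVK.
  by apply: U's; exact: map_f.
- by exists u.
- by rewrite !rhoK => <-.
Qed.

(** * Hilbert's basis theorem over a cyclic quotient *)

Section HilbertBasis.
Variables (H N : set G) (g : G) (W : set V).
Hypotheses (sgH : subgroup H) (sgN : subgroup N) (nNH : normal_in N H).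
Hypotheses (Hg : H g) (HgN : forall x, H x ->
  exists n : int, left_coset x N = left_coset (expgz g n) N).
Hypothesis nW : noetherian N W.

Let sW : submodule N W := nW.1.

Let NH : N `<=` H := nNH.1.

Let normH h : H h -> normalizes N h.
Proof.
move=> Hh n Nn; split; apply: nNH.2 => //.
exact: (subgroupV sgH).
Qed.

Let Hgn n : H (g ^+ n)%g := subgroupX sgH n Hg.

(** W + gW + ... + g^(n-1)W, the analogue of the polynomials of degree less than [n] with
    coefficients in [W]. *)
Fixpoint power_sum n : set V :=
  if n is m.+1 then sum_set (power_sum m) (rho (g ^+ m)%g @` W) else [set 0].

Local Notation Wn := power_sum.

Let noeth_Wn n : noetherian N (Wn n).
Proof.
elim: n => [|n IHn]; first exact: noetherian0.
by apply: noetherian_sum => //; apply: noetherian_translate => //; exact: normH.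
Qed.

Let sWn n : submodule N (Wn n) := (noeth_Wn n).1.

Let WnS n : Wn n `<=` Wn n.+1.
Proof.
move=> v Wv; exists v, 0; split=> //; last by rewrite addr0.
by exists 0; rewrite ?rho0 //; case: sW.
Qed.

Let Wn_le m n : (m <= n)%N -> Wn m `<=` Wn n.
Proof.
move=> /subnKC <-; elim: (n - m)%N => [|k IHk]; first by rewrite addn0.
by rewrite addnS => v /IHk; exact: WnS.
Qed.

Let Wn_g n v : Wn n v -> Wn n.+1 (rho g v).
Proof.
elim: n v => [_ ->|n IHn _ [u][_][Wu [w Ww <-] ->]].
  by rewrite rho0; case: (sWn 1).
exists (rho g u), (rho g (rho (g ^+ n)%g w)); split; [exact: IHn| |exact: rhoD].
by exists w => //; rewrite -rhoM -expgS.
Qed.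

Let Wn_gX k n v : Wn n v -> Wn (n + k)%N (rho (g ^+ k)%g v).
Proof.
move=> Wv; elim: k => [|k IHk]; first by rewrite addn0 expg0 rho1.
by rewrite addnS expgS rhoM; exact: Wn_g.
Qed.

(** The sum of g^n W over all integers n, the analogue of Laurent polynomials: a factor [g ^+ k]
    clears the negative exponents. *)
Definition power_span : set V := [set v | exists k n, Wn n (rho (g ^+ k)%g v)].

Lemma sub_power_span : W `<=` power_span.
Proof.
move=> w Ww; exists 0%N, 1%N; rewrite expg0 rho1.
exists 0, w; split=> //; last by rewrite add0r.
by exists w; rewrite // expg0 rho1.
Qed.

Let span_g v : power_span v -> power_span (rho g v).
Proof.
move=> [k [n Wv]]; exists k, n.+1.
by rewrite -rhoM -expgSr expgS rhoM; exact: Wn_g.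
Qed.

Let span_gV v : power_span v -> power_span (rho g^-1%g v).
Proof.
move=> [k [n Wv]]; exists k.+1, n.
by rewrite -rhoM expgSr -mulgA mulgV mulg1.
Qed.

Let span_sub : submodule H power_span.
Proof.
split.
- by exists 0%N, 0%N; rewrite rho0.
(* Each vector is multiplied by the clearing power of the other, which raises its degree bound
   accordingly. *)
- move=> a u v [k [n Wu]] [l [m Wv]]; exists (k + l)%N.
  exists (maxn (n + l) (m + k))%N.
  rewrite rhoP; case: (sWn (maxn (n + l) (m + k))%N) => _ + _; apply.
    rewrite [(k + l)%N]addnC expgnDr rhoM.
    by apply: (Wn_le (leq_maxl _ _)); exact: Wn_gX.
  by rewrite expgnDr rhoM; apply: (Wn_le (leq_maxr _ _)); exact: Wn_gX.
- move=> h v Hh Sv; have [z hE] := HgN Hh.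
  (* As [h] lies in its own coset, h = g^z n with n in [N]. Conjugation moves n past g^k, and g^z
     acts one factor at a time. *)
  have [n Nn <-] : left_coset (expgz g z) N h.
    by rewrite -hE; exists 1%g; rewrite ?mulg1//; exact: subgroup1.
  rewrite rhoM; have {Sv} : power_span (rho n v).
    move: Sv => [k [m Wv]]; exists k, m.
    rewrite -[n](conjgKV (g ^+ k)%g) -rho_conj.
    case: (sWn m) => _ _; apply=> //.
    by have [] := normH (Hgn k) Nn.
  move: (rho n v) => {v}u Su; case: z {hE} => m /=.
    elim: m => [|m IHm]; first by rewrite expg0 rho1.
    by rewrite expgS rhoM; exact: span_g.
  rewrite -expVgn; elim: m.+1 => [|k IHk]; first by rewrite expg0 rho1.
  by rewrite expgS rhoM; exact: span_gV.
Qed.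

(** The leading coefficients in degree [n]; one element may have several, since the sum of the
    translates need not be direct. *)
Let lead U n : set V :=
  [set w | W w /\ exists2 v, Wn n v & U (v + rho (g ^+ n)%g w)].

Let lead_sub U n : submodule H U -> submodule N (lead U n).
Proof.
move=> [U0 UP UH]; case: sW (sWn n) => W0 WP WN [Wn0 WnP WnN]; split.
- by split=> //; exists 0; rewrite // rho0 addr0.
- move=> a u v [Wu [u' Wu' Uu]] [Wv [v' Wv' Uv]]; split; first exact: WP.
  exists (a *: u' + v'); first exact: WnP.
  by rewrite rhoP addrACA -scalerDr; exact: UP.
- move=> h u Nh [Wu [u' Wu' Uu]]; split; first exact: WN.
  have [_ Nh'] := normH (Hgn n) Nh.
  (* Acting by g^n h g^(-n) on an element with leading coefficient [u] yields one with leading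
     coefficient [rho h u]. *)
  exists (rho (h ^ (g ^+ n)^-1)%g u'); first exact: WnN.
  rewrite -[X in rho X u](conjgKV (g ^+ n)%g) -rho_conj -rhoD.
  by apply: UH => //; exact: NH.
Qed.

(** Acting by [g] raises the degree by one and keeps the leading coefficient. *)
Let lead_le U m n : submodule H U -> (m <= n)%N -> lead U m `<=` lead U n.
Proof.
move=> [_ _ UH] /subnKC <-; elim: (n - m)%N => [|k IHk]; first by rewrite addn0.
rewrite addnS => w /IHk[Ww [v Wv Uv]]; split=> //.
exists (rho g v); first exact: Wn_g.
by rewrite expgS rhoM -rhoD; exact: UH.
Qed.

(** The union of the chain is a submodule of [W], and its finitely many generators all occur at one
    stage. *)
Let lead_stable U : submodule H U -> exists m, forall n, lead U n `<=` lead U m.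
Proof.
move=> sU; pose L := [set w | exists n, lead U n w].
have sL : submodule N L.
  split; first by exists 0%N; case: (lead_sub 0 sU).
    move=> a u v [m Lu] [n Lv]; exists (maxn m n).
    case: (lead_sub (maxn m n) sU) => _ + _; apply.
      exact: lead_le sU (leq_maxl _ _) _ Lu.
    exact: lead_le sU (leq_maxr _ _) _ Lv.
  by move=> h u Nh [n Lu]; exists n; case: (lead_sub n sU) => _ _; apply.
have [|s sP sgen] := nW.2 L sL; first by move=> w [n []].
have [m mP] : exists m, forall w, w \in s -> lead U m w.
  elim: s sP {sgen} => [|w s IHs] sP; first by exists 0%N.
  have [|m mP] := IHs; first by move=> v vs; apply: sP; rewrite inE vs orbT.
  have [n Lw] := sP w (mem_head _ _); exists (maxn m n) => v.
  rewrite inE => /predU1P[->|/mP Lv].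
    exact: lead_le sU (leq_maxr _ _) _ Lw.
  exact: lead_le sU (leq_maxl _ _) _ Lv.
by exists m => n w Lw; apply: (sgen _ (lead_sub m sU) mP); exists n.
Qed.

(* Hilbert's basis theorem: the leading coefficients of the elements of U form
   a chain of N-submodules of W, which stabilises at some m; then U is
   generated over H by its elements of degree at most m. *)
Lemma noetherian_power_span : noetherian H power_span.
Proof.
split=> // U sU UW; have [m mP] := lead_stable sU.
have [||s sP sgen] := (noeth_Wn m.+1).2 (U `&` Wn m.+1).
- by apply: submoduleI => //; exact: submoduleS NH sU.
- by move=> v [].
exists s; first by move=> v /sP[].
move=> U' sU' U's.
have UWm : U `&` Wn m.+1 `<=` U' by apply: sgen => //; exact: submoduleS NH sU'.
have UWn n : U `&` Wn n `<=` U'.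
  elim: n => [|n IHn] u [Uu Wu].
    by apply: UWm; split=> //; exact: Wn_le Wu.
  have [nm|mn] := leqP n m.
    by apply: UWm; split=> //; exact: Wn_le Wu.
  move: Wu => [v [_ [Wv [w Ww <-] uE]]].
  have /mP[_ [v' Wv' Uv']] : lead U n w by split=> //; exists v; rewrite -?uE.
  have Wu' : Wn m.+1 (v' + rho (g ^+ m)%g w).
    by exists v', (rho (g ^+ m)%g w); split=> //; exists w.
  have U'u' := UWm _ (conj Uv' Wu').
  (* An element of degree at most [m] with leading coefficient [w] is raised to degree [n];
     subtracting it from [u] lowers the degree. *)
  set u' := rho (g ^+ (n - m))%g (v' + rho (g ^+ m)%g w).
  have Uu' : U u' by case: sU => _ _; apply.
  rewrite -(subrK u' u); apply: (submoduleD sU'); last by case: sU' => _ _; apply.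
  apply: IHn; split; first exact: submoduleB sU _ _.
  rewrite /u' rhoD -rhoM -expgnDr subnK 1?ltnW// uE opprD addrACA subrr addr0.
  apply: (submoduleB (sWn n)) => //; rewrite -[X in Wn X](subnKC (ltnW mn)).
  exact: Wn_gX.
move=> u Uu; have [k [n Wu]] := UW _ Uu.
rewrite -(rhoVK (g ^+ k)%g u); case: (sU') => _ _; apply.
  exact: subgroupV.
by apply: (UWn n); split=> //; case: sU => _ _; apply.
Qed.

End HilbertBasis.

(** * Hall's theorem along a polycyclic series *)

Lemma polycyclic_noetherian H v :
  polycyclic H -> exists2 W, noetherian H W & W v.
Proof.
move=> [n [S [<- Sn sgS stepS]]].
(* The induction climbs from the trivial end of the series, hence the index [n - i]. *)
suff cover i : (i <= n)%N -> exists2 W, noetherian (S (n - i)%N) W & W v.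
  by have := cover n (leqnn n); rewrite subnn.
elim: i => [_|i IHi ltin].
  rewrite subn0 Sn; exists [set a *: v | a in [set: K]].
    exact: noetherian_line.
  by exists 1; rewrite ?scale1r.
have [W nW Wv] := IHi (ltnW ltin); rewrite -(subnSK ltin) in nW.
have ltn : (n - i.+1 < n)%N by rewrite ltn_subrL (leq_trans _ ltin).
have [nS [g Sg gS]] := stepS _ ltn.
exists (power_span g W).
  by apply: noetherian_power_span gS nW => //; apply: sgS => //; exact: ltnW.
exact: sub_power_span Wv.
Qed.

Lemma polycyclic_noetherian_seq H (s : seq V) : polycyclic H ->
  exists2 W, noetherian H W & forall v, v \in s -> W v.
Proof.
move=> pH; elim: s => [|v s [W nW Ws]].
  by exists [set 0]; first exact: noetherian0.
have [W' nW' W'v] := polycyclic_noetherian v pH.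
exists (sum_set W' W); first exact: noetherian_sum.
have [W0 _ _] := nW.1; have [W'0 _ _] := nW'.1.
move=> u; rewrite inE => /predU1P[->|/Ws Wu]; first by exists v, 0; rewrite addr0.
by exists 0, u; rewrite add0r.
Qed.

Lemma submodule_lincomb H U n (a : 'I_n -> K) (f : 'I_n -> V) :
  submodule H U -> (forall i, U (f i)) -> U (\sum_i a i *: f i).
Proof.
move=> sU Uf; apply: big_ind => [|u v|i _]; first by case: sU.
- exact: submoduleD sU.
- exact: submoduleZ sU _.
Qed.

End NoetherianModules.

(** * Finite transversals and linear separation *)

(** Finite index counts left cosets, while g = h t is a decomposition by right cosets; inversion
    exchanges the two, hence the lookup of the coset of [g^-1]. *)
Lemma finite_index_transversal (G : groupType) (H : set G) :
  subgroup H -> finite_index H ->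
  exists r : seq G, forall g, exists t h, [/\ t \in r, H h & g = (h * t)%g].
Proof.
move=> sgH fH.
have /choice[f fP] : forall C : set G, exists t,
    forall g, left_coset g H = C -> left_coset t H = C.
  move=> C; have [[g gC]|nC] := pselect (exists g, left_coset g H = C).
    by exists g.
  by exists 1%g => g gC; case: nC; exists g.
have /finite_seqP[r rE] := finite_image f fH.
exists [seq t^-1%g | t <- r] => g.
have fg := fP _ g^-1%g erefl.
have [h Hh hE] : left_coset (f (left_coset g^-1%g H)) H g^-1%g.
  by rewrite fg; exists 1%g; rewrite ?mulg1//; exact: subgroup1.
exists (f (left_coset g^-1%g H))^-1%g, h^-1%g; split.
- apply: map_f; suff : [set` r] (f (left_coset g^-1%g H)) by [].
  by rewrite -rE; do 2!eexists.
- exact: subgroupV.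
- by rewrite -invgM hE invgK.
Qed.

(** A matrix [B] of maximal rank with row space inside [S] has row space [S]; some column of its
    cokernel matrix then does not kill [x]. *)
Lemma rV_separation (K : fieldType) n (S : set 'rV[K]_n) (x : 'rV[K]_n) :
  GRing.submod_closed (mem S) -> ~ S x ->
  exists2 c : 'cV[K]_n, forall y, S y -> y *m c = 0 & x *m c != 0.
Proof.
move=> [/set_mem S0 Slin] nSx.
have SP a u v : S u -> S v -> S (a *: u + v).
  by move=> /mem_set Su /mem_set Sv; apply: set_mem; exact: Slin.
pose inS (B : 'M[K]_n) := forall v : 'rV_n, (v <= B)%MS -> S v.
pose P r := `[< exists2 B, inS B & \rank B = r >].
have exP : exists r, P r.
  exists 0%N; apply/asboolP; exists 0; last exact: mxrank0.
  by move=> v; rewrite submx0 => /eqP ->.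
have ubP r : P r -> (r <= n)%N by move=> /asboolP[B _ <-]; exact: rank_leq_row.
case: (ex_maxnP exP ubP) => r /asboolP[B SB rB] maxr.
(* Adjoining [y] cannot raise the maximal rank, so [y] already lies in the row space. *)
have BS y : S y -> (y <= B)%MS.
  move=> Sy; have inS' : inS (B + <<y>>)%MS.
    move=> v /sub_addsmxP[[u w] /= ->].
    have /sub_rVP[a ->] : (w *m <<y>> <= y)%MS.
      by rewrite (submx_trans (submxMl _ _)) // genmxE.
    by rewrite addrC; apply: SP => //; apply: SB; exact: submxMl.
  have /maxr : P (\rank (B + <<y>>)%MS) by apply/asboolP; exists (B + <<y>>)%MS.
  rewrite -rB => le; have := mxrank_leqif_sup (addsmxSl B <<y>>%MS).
  move=> /leqifP; case: ifP => [+ _|_]; last by rewrite ltnNge le.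
  by rewrite addsmx_sub genmxE => /andP[].
have : ~~ (x <= B)%MS by apply/negP => /SB.
rewrite submxE => /eqP/matrixP nx.
have [j nxj] : exists j, (x *m cokermx B) 0 j != 0.
  apply: contrapT => nj; apply: nx => i j; rewrite ord1 [RHS]mxE.
  by apply/eqP; apply: contrapT => /negP nij; case: nj; exists j.
exists (col j (cokermx B)); rewrite colE.
  by move=> y /BS; rewrite submxE mulmxA => /eqP ->; rewrite mul0mx.
apply: contraNneq nxj; rewrite mulmxA -colE => /matrixP/(_ 0 0).
by rewrite !mxE => ->.
Qed.

(** * Functionals on configurations *)

Section Functionals.
Variables (K : fieldType) (G : groupType) (A : vectType K).

Local Notation functional := ((G -> A) -> K^o).

Definition translate (g : G) (phi : functional) : functional :=
  fun x => phi (shift g^-1%g x).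

Definition evaluation (g : G) i : functional :=
  fun x => coord (vbasis {:A}) i (x g).

Lemma shift_mul (g h : G) (x : G -> A) : shift (g * h)%g x = shift g (shift h x).
Proof. by apply/funext => k; rewrite /shift invgM mulgA. Qed.

Lemma shift_one (x : G -> A) : shift 1%g x = x.
Proof. by apply/funext => k; rewrite /shift invg1 mul1g. Qed.

Lemma translate_linear g : linear (translate g).
Proof. by []. Qed.

Lemma translate1 phi : translate 1%g phi = phi.
Proof. by apply/funext => x; rewrite /translate invg1 shift_one. Qed.

Lemma translateM g h phi : translate (g * h)%g phi = translate g (translate h phi).
Proof. by apply/funext => x; rewrite /translate invgM shift_mul. Qed.

Lemma translate_evaluation g h i :
  translate g (evaluation h i) = evaluation (g * h)%g i.
Proof. by apply/funext => x; rewrite /translate /evaluation /shift invgK. Qed.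

Definition finitely_supported (phi : functional) : Prop :=
  exists s : seq G, forall x y, {in s, x =1 y} -> phi x = phi y.

Lemma finitely_supported_submodule :
  submodule translate [set: G] finitely_supported.
Proof.
split.
- by exists [::].
- move=> a u v [s su] [t tv]; exists (s ++ t) => x y xy.
  rewrite !fctE (su x y) ?(tv x y)// => g gs; apply: xy;
  by rewrite mem_cat gs ?orbT.
- move=> h u _ [s su]; exists [seq (h * g)%g | g <- s] => x y xy.
  by apply: su => g gs; rewrite /shift invgK; apply: xy; exact: map_f.
Qed.

(** Evaluations at a finite transversal suffice as a seed: [h] in [H] carries the evaluation at [t]
    to the one at [h * t]. *)
Lemma evaluation_noetherian : polycyclic_by_finite G ->
  exists H W, noetherian translate H W /\ forall g i, W (evaluation g i).
Proof.
move=> [H [sgH pH /(finite_index_transversal sgH)[r rP]]].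
pose s := [seq evaluation t i | t <- r, i <- enum 'I_(\dim {:A})].
have [W nW Ws] :=
  polycyclic_noetherian_seq translate_linear translate1 translateM s pH.
exists H, W; split=> // g i; have [t [h [tr Hh ->]]] := rP g.
rewrite -translate_evaluation; case: nW.1 => _ _; apply=> //; apply: Ws.
by apply/allpairsP; exists (t, i); rewrite mem_enum.
Qed.

(** Otherwise the traces on [Sigma] of the cylinders around [x] generate a proper filter converging
    to [x], and closedness puts [x] in [Sigma]. *)
Lemma closed_prodiscrete_cylinder (Sigma : set (G -> A)) x :
  closed (Sigma : set (prodiscrete G A)) -> ~ Sigma x ->
  exists s : seq G, forall y, {in s, y =1 x} -> ~ Sigma y.
Proof.
move=> cSigma nSx; apply: contrapT => nocyl; apply: nSx; apply: cSigma.
pose cyl (s : seq G) : set (prodiscrete G A) :=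
  [set y | Sigma y /\ {in s, y =1 x}].
have cylF : Filter (filter_from [set: seq G] cyl).
  apply: filter_from_filter; first by exists [::].
  move=> s t _ _; exists (s ++ t) => // y [Sy yx].
  by split; split=> // g gs; apply: yx; rewrite mem_cat gs ?orbT.
rewrite closureEcvg; exists (filter_from [set: seq G] cyl).
  apply: filter_from_proper => s _.
  apply: contrapT => ns; apply: nocyl; exists s => y yx Sy.
  by apply: ns; exists y.
split; last by move=> B SB; exists [::] => // y [] /SB.
(* Convergence in the product is tested one coordinate at a time, so the cylinder on [[:: g]] is
   enough. *)
apply/cvg_sup => g U [_ [[W _ <-] Wx WU]].
by exists [:: g] => // y [_ yx]; apply: WU; rewrite /= yx ?mem_head.
Qed.

Lemma functional_separation (Sigma : set (G -> A)) (W : set functional) H x :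
  linear_subshift Sigma -> ~ Sigma x ->
  submodule translate H W -> (forall g i, W (evaluation g i)) ->
  exists phi, [/\ W phi, finitely_supported phi,
    forall y, Sigma y -> phi y = 0 & phi x != 0].
Proof.
move=> [cS _ [/set_mem S0 Slin]] nSx sW Wev.
have [s sP] := closed_prodiscrete_cylinder cS nSx.
pose fs := [seq evaluation g i | g <- s, i <- enum 'I_(\dim {:A})].
have fsE (k : 'I_(size fs)) :
    exists g i, g \in s /\ nth 0 fs k = evaluation g i.
  by have /allpairsP[[g i] [gs _ ->]] := mem_nth 0 (ltn_ord k); exists g, i.
pose pi (y : G -> A) : 'rV[K]_(size fs) := \row_k (nth 0 fs k y).
have piP a y z : pi (a *: y + z) = a *: pi y + pi z.
  apply/rowP => k; rewrite !mxE; have [g [i [_ ->]]] := fsE k.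
  by rewrite /evaluation !fctE linearP.
(* Basis coordinates recover the values on [s], so a point of [Sigma] with the same image as [x]
   would lie in the excluded cylinder. *)
have eq_pi y z : pi y = pi z -> {in s, y =1 z}.
  move=> /rowP yz g gs.
  rewrite (coord_vbasis (memvf (y g))) (coord_vbasis (memvf (z g))).
  apply: eq_bigr => i _; congr (_ *: _).
  have gfs : evaluation g i \in fs.
    by apply/allpairsP; exists (g, i); rewrite mem_enum.
  have := yz (Ordinal (etrans (index_mem _ _) gfs)).
  by rewrite !mxE /= nth_index.
have [||c cS' cx] := @rV_separation _ _ (pi @` Sigma) (pi x).
- split.
    apply/mem_set; exists 0 => //; apply/rowP => k; rewrite !mxE.
    by have [g [i [_ ->]]] := fsE k; rewrite /evaluation linear0.
  move=> a _ _ /set_mem[y /mem_set Sy <-] /set_mem[z /mem_set Sz <-].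
  by apply/mem_set; exists (a *: y + z); rewrite ?piP//; apply: set_mem; exact: Slin.
- by move=> [y Sy /eq_pi/sP]; apply.
pose phi : functional := \sum_(k < size fs) c k 0 *: nth 0 fs k.
have phiE y : phi y = (pi y *m c) 0 0.
  rewrite /phi fct_sumE mxE; apply: eq_bigr => k _.
  by rewrite !mxE mulrC.
exists phi; split.
- apply: (submodule_lincomb _ sW) => k.
  by have [g [i [_ ->]]] := fsE k.
- exists s => y z yz; rewrite !phiE; congr ((_ *m _) _ _); apply/rowP => k.
  by rewrite !mxE; have [g [i [gs ->]]] := fsE k; rewrite /evaluation yz.
- by move=> y Sy; rewrite phiE cS' ?mxE//; exists y.
- apply: contraNneq cx => phi0; apply/eqP/matrixP => i j.
  by rewrite !ord1 -phiE phi0 mxE.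
Qed.

End Functionals.

(** * Linear subshifts are of finite type *)

Lemma polycyclic_by_finite_linear_markov (K : fieldType) (G : groupType) :
  polycyclic_by_finite G -> linear_markov_type K G.
Proof.
move=> pG A Sigma lS; have [_ shiftS _] := lS.
have [H [W [[sW nW] Wev]]] := evaluation_noetherian A pG.
pose ann : set ((G -> A) -> K^o) := [set phi | forall y, Sigma y -> phi y = 0].
have sann : submodule (@translate K G A) H ann.
  split=> // [a u v au av y Sy|h u _ au y Sy]; last by apply: au; exact: shiftS.
  by rewrite !fctE au// av// scaler0 addr0.
have sfs := submoduleS (@subsetT _ H) (@finitely_supported_submodule K G A).
have sU := submoduleI sW (submoduleI sfs sann).
have [|s sP sgen] := nW _ sU; first by move=> phi [].
have [D DP] : exists D : seq G, forall phi, phi \in s ->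
    forall x y, {in D, x =1 y} -> phi x = phi y.
  elim: s sP {sgen} => [|phi s IHs] sP; first by exists [::].
  have [|D DP] := IHs; first by move=> psi ps; apply: sP; rewrite inE ps orbT.
  have [_ [[E EP] _]] := sP phi (mem_head _ _).
  exists (D ++ E) => psi; rewrite inE => /predU1P[->|ps] x y xy.
    by apply: EP => g gE; apply: xy; rewrite mem_cat gE orbT.
  by apply: (DP psi) => // g gD; apply: xy; rewrite mem_cat gD.
(* [D] supports all the generators; the allowed patterns are those that [Sigma] shows on [D]. *)
exists [set` D], [set sigL [set` D] y | y in Sigma]; split; first exact: finite_seq.
apply/seteqP; split=> [x Sx g|x Px].
  by exists (shift g^-1%g x) => //; exact: shiftS.
apply: contrapT => nSx.
have [phi [Wphi fphi annphi]] := functional_separation lS nSx sW Wev.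
suff -> : phi x = 0 by rewrite eqxx.
(* Vanishing on the whole G-orbit of [x] is preserved by [H], so only the generators have to be
   checked. *)
pose U' : set ((G -> A) -> K^o) := [set psi | forall g, psi (shift g^-1%g x) = 0].
have sU' : submodule (@translate K G A) H U'.
  split=> // [a u v au av g|h u _ au g]; first by rewrite !fctE au av scaler0 addr0.
  by rewrite /translate -shift_mul -invgM au.
have U's psi : psi \in s -> U' psi.
  (* On [D] the shifted [x] agrees with some [y] in [Sigma], and [psi] sees only [D]. *)
  move=> ps g; have [y Sy yE] := Px g.
  have [_ [_ annpsi]] := sP _ ps; rewrite -(annpsi y Sy).
  apply: (DP psi) => // d dD; apply/esym.
  exact: (congr1 (fun f => f (exist _ d (mem_set dD))) yE).
have := sgen U' sU' U's phi (conj Wphi (conj fphi annphi)) 1%g.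
by rewrite invg1 shift_one.
Qed.

(** * Free abelian groups *)

Lemma subgroup_setT (G : groupType) : subgroup [set: G].
Proof. by split=> [|u v _ _]; exact: mem_set. Qed.

Lemma finite_index_setT (G : groupType) : finite_index [set: G].
Proof.
apply: sub_finite_set (finite_set1 [set: G]) => _ [g _ <-].
apply/seteqP; split=> // x _.
by exists (g^-1 * x)%g; rewrite // mulgA mulgV mul1g.
Qed.

Lemma expgz_to_multiplicative (V : zmodType) (v : V) (n : int) :
  expgz (v : Algebra.to_multiplicative V) n = v *~ n.
Proof. by case: n. Qed.

Lemma left_coset_subgroup (G : groupType) (N : set G) (x y : G) :
  subgroup N -> N (y^-1 * x)%g -> left_coset x N = left_coset y N.
Proof.
move=> sgN Nyx; apply/seteqP; split=> _ [n Nn <-].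
  exists (y^-1 * x * n)%g; first exact: subgroupM.
  by rewrite !mulgA mulgV mul1g.
exists ((y^-1 * x)^-1 * n)%g; first by apply: subgroupM => //; exact: subgroupV.
by rewrite invgM invgK !mulgA mulgV mul1g.
Qed.

Lemma free_abelian_polycyclic d : polycyclic [set: free_abelian d].
Proof.
(* The series kills one more coordinate at each step; for [i < d] a basis vector generates the
   quotient. *)
pose S i : set (free_abelian d) :=
  [set v : 'rV[int]_d | forall j : 'I_d, (j < i)%N -> v 0 j = 0].
have sgS i : subgroup (S i).
  split; first by apply/mem_set => j _; rewrite mxE.
  move=> u v /set_mem Su /set_mem Sv; apply/mem_set => j ji.
  by rewrite /= !mxE Su// Sv// subr0.
exists d, S; split=> //.
- by apply/seteqP; split.
- apply/seteqP; split=> [v Sv|_ ->]; last by move=> j _; rewrite mxE.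
  by apply/rowP => j; rewrite Sv ?mxE.
move=> i ltid; split.
  split=> [v Sv j ji|g v _ Sv]; first by apply: Sv; exact: ltnW.
  suff -> : (v ^ g)%g = v by [].
  rewrite conjgE; change (- (g : 'rV_d) + ((v : 'rV_d) + g) = v).
  by rewrite [X in _ + X]addrC addKr.
pose k := Ordinal ltid; exists (delta_mx 0 k : 'rV[int]_d) => [j ji|x Sx].
  by rewrite mxE eqxx -val_eqE /= ltn_eqF.
(* Subtracting this multiple of the basis vector kills coordinate [i]; the earlier ones vanish
   already. *)
exists ((x : 'rV[int]_d) 0 k); apply: left_coset_subgroup => // j.
rewrite ltnS leq_eqVlt expgz_to_multiplicative -scaler_int intz => ji.
change ((- ((x : 'rV[int]_d) 0 k *: delta_mx 0 k) + (x : 'rV[int]_d)) 0 j = 0).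
rewrite !mxE eqxx /=; case/predU1P: ji => [ji|ji].
  by rewrite (_ : j = k) ?eqxx ?mulr1 ?addNr//; exact: val_inj.
by rewrite -val_eqE /= ltn_eqF// mulr0 oppr0 add0r Sx.
Qed.

Theorem corollary1p4 (K : fieldType) :
  (forall G : groupType, polycyclic_by_finite G -> linear_markov_type K G) /\
  (forall d : nat, (1 <= d)%N ->
     polycyclic_by_finite (free_abelian d) /\
     linear_markov_type K (free_abelian d)).
Proof.
have markov := @polycyclic_by_finite_linear_markov K.
split=> // d _; suff pbf : polycyclic_by_finite (free_abelian d).
  by split=> //; exact: markov.
exists [set: free_abelian d]; split.
- exact: subgroup_setT.
- exact: free_abelian_polycyclic.
- exact: finite_index_setT.
Qed.
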